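(* Let $\mathcal{A}$ be a uniformly complete Archimedean ordered $^*$-algebra. Then the following properties are all equivalent: (1) All elements of the form $a+\mathrm{i}\mathbb{1}$ and $a-\mathrm{i}\mathbb{1}$ with $a\in\mathcal{A}_{\mathrm{H}}$ are invertible. (2) All coercive elements in $\mathcal{A}_{\mathrm{H}}$ are invertible, i.e. $\mathcal{A}$ is symmetric. (3) $\mathcal{A}$ is radical and the square root $\sqrt{a}$ exists for all $a\in\mathcal{A}_{\mathrm{H}}^+$. (4) $\mathcal{A}$ is radical and the absolute value $|a|$ exists for all $a\in\mathcal{A}_{\mathrm{H}}$. (5) $\mathcal{A}$ is radical and both $a\vee b$ and $a\wedge b$ exist for all commuting $a,b\in\mathcal{A}_{\mathrm{H}}$, i.e. $\mathcal{A}$ is a $\Phi^*$-algebra. (6) $\mathcal{A}$ is radical and $a\wedge\mathbb{1}$ exists for all coercive $a\in\mathcal{A}_{\mathrm{H}}^+$.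
   Context: A $^*$-algebra is a unital associative complex algebra $\mathcal{A}$ (unit $\mathbb{1}$; the zero algebra is allowed) with an antilinear involution $a\mapsto a^*$ satisfying $(ab)^*=b^*a^*$; $\mathcal{A}_{\mathrm{H}}=\{a\in\mathcal{A}: a=a^*\}$ denotes the real vector space of Hermitian elements. An ordered $^*$-algebra is a $^*$-algebra $\mathcal{A}$ with a partial order $\le$ on $\mathcal{A}_{\mathrm{H}}$ such that $a+c\le b+c$, $d^*ad\le d^*bd$ and $0\le\mathbb{1}$ for all $a,b,c\in\mathcal{A}_{\mathrm{H}}$ with $a\le b$ and all $d\in\mathcal{A}$. Write $\mathcal{A}_{\mathrm{H}}^+=\{a\in\mathcal{A}_{\mathrm{H}}: a\ge 0\}$. It is Archimedean if, for $v,w\in\mathcal{A}_{\mathrm{H}}$, $v\le\epsilon w$ for all $\epsilon>0$ implies $v\le 0$. For $a\in\mathcal{A}$ let $\|a\|_\infty=\inf\{\lambda\in\,]0,\infty[\,: a^*a\le\lambda^2\mathbb{1}\}\in[0,\infty]$ ($\inf\emptyset=\infty$). If $\mathcal{A}$ is an Archimedean ordered $^*$-algebra, the uniform metric is $\mathrm{d}_\infty(a,b)=\min\{\|a-b\|_\infty,1\}$, and $\mathcal{A}$ is uniformly complete if it is complete with respect to $\mathrm{d}_\infty$. An element $a\in\mathcal{A}_{\mathrm{H}}$ is coercive if there is $\epsilon>0$ with $a\ge\epsilon\mathbb{1}$. $\mathcal{A}$ is symmetric if every coercive element has a multiplicative inverse in $\mathcal{A}$. $\mathcal{A}$ is radical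 if, whenever $a,b\in\mathcal{A}_{\mathrm{H}}$ commute, $a$ is coercive and $ab\ge 0$, then $b\ge 0$. For $S\subseteq\mathcal{A}$, $S'=\{a\in\mathcal{A}: sa=as\ \forall s\in S\}$ is the commutant and $S''=(S')'$ the bicommutant. In a radical Archimedean ordered $^*$-algebra, for commuting $a,b\in\mathcal{A}_{\mathrm{H}}$: $a\vee b$ is (if it exists) the (necessarily unique) $x\in\{a,b\}''\cap\mathcal{A}_{\mathrm{H}}$ with $2x\ge a+b$ and $x^2+ab=x(a+b)$; $a\wedge b$ is (if it exists) the (necessarily unique) $x\in\{a,b\}''\cap\mathcal{A}_{\mathrm{H}}$ with $2x\le a+b$ and $x^2+ab=x(a+b)$. The absolute value of $a\in\mathcal{A}_{\mathrm{H}}$ is $|a|=a\vee(-a)$ (if it exists). The square root of $a\in\mathcal{A}_{\mathrm{H}}^+$ is (if it exists) the (necessarily unique) element $\sqrt{a}\in\{a\}''\cap\mathcal{A}_{\mathrm{H}}^+$ with $\sqrt{a}^{\,2}=a$. A $\Phi^*$-algebra is a radical Archimedean ordered $^*$-algebra in which $a\vee b$ and $a\wedge b$ exist for all commuting Hermitian $a,b$. *)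

(* Defs.v *)
From HB Require Import structures.
From mathcomp Require Import all_boot all_order all_algebra.
From mathcomp Require Import all_classical all_reals all_analysis.
From mathcomp Require Import complex.

Set Implicit Arguments.
Unset Strict Implicit.
Unset Printing Implicit Defensive.

Import Order.TTheory GRing.Theory Num.Theory.
Local Open Scope classical_set_scope.
Local Open Scope complex_scope.
Local Open Scope ring_scope.

(* The scalar multiplication is part of the mixin because [algType R[i]]
   requires [1 != 0], whereas the zero algebra is a *-algebra. *)
HB.mixin Record isStarAlgebra (R : realType) A of GRing.PzRing A := {
  star_scale : R[i] -> A -> A ;
  star_scaleA : forall (y z : R[i]) (a : A),
    star_scale y (star_scale z a) = star_scale (y * z) a ;
  star_scale1 : forall a : A, star_scale 1 a = a ;
  star_scaleDr : forall (z : R[i]) (a b : A),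
    star_scale z (a + b) = star_scale z a + star_scale z b ;
  star_scaleDl : forall (a : A) (y z : R[i]),
    star_scale (y + z) a = star_scale y a + star_scale z a ;
  star_scaleAl : forall (z : R[i]) (a b : A),
    star_scale z (a * b) = star_scale z a * b ;
  star_scaleAr : forall (z : R[i]) (a b : A),
    star_scale z (a * b) = a * star_scale z b ;
  star : A -> A ;
  starK : forall a : A, star (star a) = a ;
  starD : forall a b : A, star (a + b) = star a + star b ;
  starZ : forall (z : R[i]) (a : A),
    star (star_scale z a) = star_scale (conjc z) (star a) ;
  starM : forall a b : A, star (a * b) = star b * star a }.

#[short(type="starAlgType")]
HB.structure Definition StarAlgebra (R : realType) :=
  { A of GRing.PzRing A & isStarAlgebra R A }.

Notation "z **: a" := (star_scale z a)
  (at level 40, left associativity) : ring_scope.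

Definition is_herm (R : realType) (A : starAlgType R) : set A :=
  [set a | star a = a].

(* The partial order lives on Hermitian elements only: [hle] is a relation on
   the whole carrier which, by [hle_herm], never holds outside of them. *)
HB.mixin Record isOrderedStarAlgebra (R : realType) A of StarAlgebra R A := {
  hle : A -> A -> Prop ;
  hle_herm : forall a b : A, hle a b -> is_herm a /\ is_herm b ;
  hle_refl : forall a : A, is_herm a -> hle a a ;
  hle_anti : forall a b : A, hle a b -> hle b a -> a = b ;
  hle_trans : forall a b c : A, hle a b -> hle b c -> hle a c ;
  hle_add : forall a b c : A, is_herm c -> hle a b -> hle (a + c) (b + c) ;
  hle_conj : forall a b d : A,
    hle a b -> hle (star d * a * d) (star d * b * d) ;
  hle_01 : hle 0 1 }.

#[short(type="orderedStarAlgType")]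
HB.structure Definition OrderedStarAlgebra (R : realType) :=
  { A of StarAlgebra R A & isOrderedStarAlgebra R A }.

Notation "a <=h b" := (hle a b) (at level 70, no associativity) : ring_scope.

Section OrderedStarAlgebraTheory.
Variables (R : realType) (A : orderedStarAlgType R).
Implicit Types (a b x : A) (S : set A).

Definition hpos : set A := [set a | 0 <=h a].

Definition archimedean_alg : Prop :=
  forall v w : A, is_herm v -> is_herm w ->
    (forall e : R, 0 < e -> v <=h e%:C **: w) -> v <=h 0.

Definition unorm a : \bar R :=
  ereal_inf [set l%:E | l in
    [set l : R | 0 < l /\ star a * a <=h (l ^+ 2)%:C **: 1]].

Definition udist a b : \bar R := Order.min (unorm (a - b)) 1%:E.

Definition ucauchy (u : nat -> A) : Prop :=
  forall e : R, 0 < e -> exists N : nat, forall m n : nat,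
    (N <= m)%N -> (N <= n)%N -> (udist (u m) (u n) < e%:E)%E.

Definition ucvg_to (u : nat -> A) (l : A) : Prop :=
  forall e : R, 0 < e -> exists N : nat, forall n : nat,
    (N <= n)%N -> (udist (u n) l < e%:E)%E.

Definition uniformly_complete : Prop :=
  forall u : nat -> A, ucauchy u -> exists l : A, ucvg_to u l.

Definition is_invertible a : Prop := exists b : A, a * b = 1 /\ b * a = 1.

Definition coercive a : Prop :=
  is_herm a /\ exists e : R, 0 < e /\ e%:C **: 1 <=h a.

Definition symmetric_alg : Prop := forall a, coercive a -> is_invertible a.

Definition radical_alg : Prop :=
  forall a b, is_herm a -> is_herm b -> GRing.comm a b ->
    coercive a -> 0 <=h a * b -> 0 <=h b.

Definition commutant S : set A := [set a | forall s, S s -> s * a = a * s].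

Definition bicommutant S : set A := commutant (commutant S).

(* In a radical Archimedean algebra at most one [x] satisfies [is_join a b x]
   (likewise [is_meet], [is_abs], [is_sqrt]), so that "the join exists" is
   [exists x, is_join a b x]. *)
Definition is_join a b x : Prop :=
  [/\ bicommutant [set a; b] x, is_herm x,
      a + b <=h x *+ 2 & x ^+ 2 + a * b = x * (a + b)].

Definition is_meet a b x : Prop :=
  [/\ bicommutant [set a; b] x, is_herm x,
      x *+ 2 <=h a + b & x ^+ 2 + a * b = x * (a + b)].

Definition is_abs a x : Prop := is_join a (- a) x.

Definition is_sqrt a x : Prop :=
  [/\ bicommutant [set a] x, hpos x & x ^+ 2 = a].

Definition phi_star_alg : Prop :=
  [/\ archimedean_alg, radical_alg &
      forall a b, is_herm a -> is_herm b -> GRing.comm a b ->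
        (exists x, is_join a b x) /\ (exists x, is_meet a b x)].

End OrderedStarAlgebraTheory.

Arguments archimedean_alg {R} A.
Arguments uniformly_complete {R} A.
Arguments symmetric_alg {R} A.
Arguments radical_alg {R} A.
Arguments phi_star_alg {R} A.

(* Main.v *)
(** All constructions take place inside the bicommutant of one element or of two
commuting ones. Its Hermitian part is a commutative ring whose positive cone is
Archimedean and stable under multiplication by squares, and it is uniformly
complete and closed under inversion; so it suffices to work in such a ring.

There, completeness gives inverses of bounded coercive elements (Neumann
series) and square roots of bounded positive elements (iteration). If
[s = (a^2 + 1)^-1] exists and [a >= e > 0], then [a^2 s = 1 - s] is bounded
and coercive, hence [a] is invertible. In the symmetric case
[t = (1 + a)^-1] is bounded for [a >= 0] and
[sqrt a = sqrt (1 - t) sqrt t (1 + a)], while [b = sqrt (a^-1)^2 (a b)] gives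
radicality. Absolute values are [sqrt (a^2)], and joins and meets are
[(a + b +- |a - b|) / 2]. Finally, if [c >= 1] and the elements [c /\ n]
exist, then their inverses [(c /\ n)^-1] form a Cauchy sequence whose limit
inverts [c]; apply this to [c = a^2 + 1 = (a + i)(a - i)]. *)

Require Import Defs.
From HB Require Import structures.
From mathcomp Require Import all_boot all_order all_algebra.
From mathcomp Require Import all_classical all_reals all_analysis.
From mathcomp Require Import complex.
From mathcomp Require Import ring lra.

Set Implicit Arguments.
Unset Strict Implicit.
Unset Printing Implicit Defensive.

Import Order.TTheory GRing.Theory Num.Theory.
Local Open Scope classical_set_scope.
Local Open Scope complex_scope.
Local Open Scope ring_scope.

(* Products of positive elements need not be positive: only multiplication by
   squares is required to preserve the cone. *)
Record archimedean_cone (R : realType) (B : comPzRingType)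
    (sc : R -> B) (pos : B -> Prop) : Prop := {
  coneD : forall a b, pos a -> pos b -> pos (a + b) ;
  cone_sqrM : forall x a, pos a -> pos (x ^+ 2 * a) ;
  cone1 : pos 1 ;
  cone_anti : forall a, pos a -> pos (- a) -> a = 0 ;
  cone_arch : forall a w, (forall e : R, 0 < e -> pos (a + sc e * w)) ->
    pos a }.

(** * Complete Archimedean cones in commutative rings *)

Section ArchimedeanCone.
Variables (R : realType) (B : comPzRingType) (sc : {rmorphism R -> B}).
Variables (pos : B -> Prop) (K : archimedean_cone sc pos).
Implicit Types (a b c x y z w : B) (e l m r : R).

(** An order interval in place of a norm ball; for [l > 0] it amounts to [x^2 <= l^2], which is how
    the uniform norm measures Hermitian elements. *)
Definition bounded_by x l : Prop := pos (sc l - x) /\ pos (sc l + x).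

Definition cone_cvg (u : nat -> B) x : Prop := forall e, 0 < e ->
  exists N : nat, forall n : nat, (N <= n)%N -> bounded_by (u n - x) e.

Definition cone_complete : Prop := forall u : nat -> B,
  (forall e, 0 < e -> exists N : nat, forall m n : nat,
     (N <= m)%N -> (N <= n)%N -> bounded_by (u m - u n) e) ->
  exists x, cone_cvg u x.

Definition cone_symmetric : Prop :=
  forall a e, 0 < e -> pos (a - sc e) -> exists t, a * t = 1.

Definition cone_radical : Prop :=
  forall a b e, 0 < e -> pos (a - sc e) -> pos (a * b) -> pos b.

Lemma cone_sqr x : pos (x ^+ 2).
Proof. by rewrite -[_ ^+ 2]mulr1; apply: (cone_sqrM K); apply: (cone1 K). Qed.

Lemma cone0 : pos 0.
Proof. by have := cone_sqr 0; rewrite expr0n. Qed.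

(** A nonnegative real is a square, so scaling is a case of [cone_sqrM]. *)
Lemma coneZ r x : 0 <= r -> pos x -> pos (sc r * x).
Proof.
by move=> r0 px; rewrite -(sqr_sqrtr r0) rmorphXn; apply: (cone_sqrM K).
Qed.

Lemma coneC r : 0 <= r -> pos (sc r).
Proof.
by move=> r0; rewrite -[sc r]mulr1; apply: coneZ => //; apply: (cone1 K).
Qed.

Lemma coneZK r x : 0 < r -> pos (sc r * x) -> pos x.
Proof.
move=> r0 /(coneZ (ltW _ : 0 <= r^-1)); rewrite invr_gt0 => /(_ r0).
by rewrite mulrA -rmorphM mulVf ?gt_eqF// rmorph1 mul1r.
Qed.

Lemma coneMn n x : pos x -> pos (x *+ n).
Proof.
move=> px; elim: n => [|n IH]; rewrite ?mulr0n ?mulrS; first exact: cone0.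
exact: (coneD K).
Qed.

(** The weight [w] is arbitrary, so errors may be measured against an unbounded element. *)
Lemma arch_eq0 x w :
  (forall e, 0 < e -> pos (sc e * w - x) /\ pos (sc e * w + x)) -> x = 0.
Proof.
by move=> H; apply: (cone_anti K); apply: (cone_arch K) (w) _ => e /H[] *;
  rewrite addrC.
Qed.

Lemma bounded_by_eq0 x : (forall e, 0 < e -> bounded_by x e) -> x = 0.
Proof. by move=> H; apply: (@arch_eq0 _ 1) => e /H[]; rewrite mulr1. Qed.

Lemma bounded_by_arch x l :
  (forall e, 0 < e -> bounded_by x (l + e)) -> bounded_by x l.
Proof.
by move=> H; split; apply: (cone_arch K) 1 _ => e /H[];
  rewrite rmorphD mulr1 => H1 H2; rewrite addrAC.
Qed.

Lemma bounded_by_le x l m : l <= m -> bounded_by x l -> bounded_by x m.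
Proof.
move=> lm [H1 H2].
have H : pos (sc (m - l)) by apply: coneC; rewrite subr_ge0.
by split; [have := coneD K H1 H | have := coneD K H2 H]; congr pos; ring.
Qed.

Lemma bounded_byC l : 0 <= l -> bounded_by (sc l) l.
Proof.
move=> l0; split; rewrite ?subrr -?rmorphD; first exact: cone0.
by apply: coneC; lra.
Qed.

Lemma bounded_by00 : bounded_by 0 0.
Proof. by rewrite -{1}(rmorph0 sc); apply: bounded_byC. Qed.

Lemma bounded_byD x y l m :
  bounded_by x l -> bounded_by y m -> bounded_by (x + y) (l + m).
Proof.
by move=> [H1 H2] [H3 H4]; split;
  [have := coneD K H1 H3 | have := coneD K H2 H4]; congr pos; ring.
Qed.

Lemma bounded_byN x l : bounded_by x l -> bounded_by (- x) l.
Proof. by case=> *; split; rewrite ?opprK. Qed.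

Lemma bounded_byB x y l m :
  bounded_by x l -> bounded_by y m -> bounded_by (x - y) (l + m).
Proof. by move=> H /bounded_byN; apply: bounded_byD. Qed.

Lemma bounded_byBC x y l : bounded_by (x - y) l -> bounded_by (y - x) l.
Proof. by move=> /bounded_byN; rewrite opprB. Qed.

(** Two identities avoid products of positive elements: [2l (l^2 - x^2) = (l - x)^2 (l + x) + (l +
    x)^2 (l - x)] and [2l (l - x) = (l^2 - x^2) + (l - x)^2], the latter also with [- x] for [x]. *)
Lemma bounded_by_sqr x l :
  0 < l -> bounded_by x l <-> pos (sc (l ^+ 2) - x ^+ 2).
Proof.
move=> l0; split=> [[H1 H2]|H].
  apply: (@coneZK (2 * l)); first lra.
  have := coneD K (cone_sqrM K (sc l - x) H2) (cone_sqrM K (sc l + x) H1).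
  by congr pos; ring.
split; apply: (@coneZK (2 * l)); try lra.
  by have := coneD K H (cone_sqr (sc l - x)); congr pos; ring.
by have := coneD K H (cone_sqr (sc l + x)); congr pos; ring.
Qed.

Lemma bounded_by0 x : bounded_by x 0 -> x = 0.
Proof.
by case; rewrite rmorph0 !add0r => ? ?; exact: (cone_anti K).
Qed.

(** For positive [l] and [m], use [l^2 m^2 - x^2 y^2 = m^2 (l^2 - x^2) + x^2 (m^2 - y^2)]. *)
Lemma bounded_byM x y l m : 0 <= l -> 0 <= m ->
  bounded_by x l -> bounded_by y m -> bounded_by (x * y) (l * m).
Proof.
rewrite le0r => /predU1P[->|l0].
  by move=> _ /bounded_by0-> _; rewrite !mul0r; exact: bounded_by00.
rewrite le0r => /predU1P[->|m0].
  by move=> _ /bounded_by0->; rewrite !mulr0; exact: bounded_by00.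
rewrite !bounded_by_sqr ?mulr_gt0// => H1 H2.
have := coneD K (coneZ (sqr_ge0 m) H1) (cone_sqrM K x H2).
by congr pos; ring.
Qed.

Lemma bounded_byZ x l r : 0 <= l -> 0 <= r ->
  bounded_by x l -> bounded_by (sc r * x) (r * l).
Proof. by move=> l0 r0 H; apply: bounded_byM => //; apply: bounded_byC. Qed.

(** * Dominated sequences, bounded inverses and bounded square roots *)

Lemma bounded_nondecreasing_cauchy (q : nat -> R) M :
  (forall n, q n <= q n.+1) -> (forall n, q n <= M) ->
  forall e, 0 < e -> exists N : nat, forall m n : nat,
    (N <= m)%N -> (m <= n)%N -> q n - q m <= e.
Proof.
move=> qS qM e e0.
have qmono (m n : nat) : (m <= n)%N -> q m <= q n.
  by move=> mn; apply: (homo_leq (r := <=%R)) => // ? ? ?; apply: le_trans.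
have hs : has_sup (range q).
  by split; [exists (q 0), 0 | exists M => _ [n _ <-]].
have [_ [N _ <-] HN] := sup_adherent e0 hs.
exists N => m n Nm mn.
have := ub_le_sup (proj2 hs) (imageT q n); have := qmono _ _ Nm; lra.
Qed.

(** Majorant method: telescoping bounds [u n - u m] by [q n - q m], and [q] is Cauchy because it is
    monotone and bounded. *)
Lemma dominated_cvg (u : nat -> B) (q : nat -> R) M : cone_complete ->
  (forall n, q n <= q n.+1) -> (forall n, q n <= M) ->
  (forall n, bounded_by (u n.+1 - u n) (q n.+1 - q n)) ->
  exists x, cone_cvg u x.
Proof.
move=> complB qS qM du; apply: complB => e e0.
have dmn (m n : nat) : (m <= n)%N -> bounded_by (u n - u m) (q n - q m).
  elim: n => [|n IH].
    by rewrite leqn0 => /eqP->; rewrite !subrr; exact: bounded_by00.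
  rewrite leq_eqVlt => /predU1P[->|/IH H].
    by rewrite !subrr; exact: bounded_by00.
  have := bounded_byD (du n) H.
  by rewrite !addrA !subrK.
have [N HN] := bounded_nondecreasing_cauchy qS qM e0.
exists N => m n Nm Nn; case/orP: (leq_total m n) => mn.
  apply: bounded_byBC; exact: bounded_by_le (HN _ _ Nm mn) (dmn _ _ mn).
exact: bounded_by_le (HN _ _ Nn mn) (dmn _ _ mn).
Qed.

(** One index serves two consecutive terms, so that a recursion for [u] can be passed to the
    limit. *)
Lemma cvg_shift (u : nat -> B) x e : 0 < e -> cone_cvg u x ->
  exists n, bounded_by (u n - x) e /\ bounded_by (u n.+1 - x) e.
Proof. by move=> e0 /(_ e e0)[N HN]; exists N; split; apply: HN. Qed.

Lemma neumann z k : cone_complete -> 0 < k -> k < 1 -> bounded_by z k ->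
  exists t, (1 - z) * t = 1.
Proof.
move=> complB k0 k1 zk.
(* [u n] is the partial sum of the Neumann series in [z], and [q n] that of the geometric series in
   [k]. *)
pose u n := iter n (fun y => 1 + z * y) 0.
pose q n := (1 - k ^+ n) / (1 - k).
have dq n : q n.+1 - q n = k ^+ n.
  by rewrite /q exprS; field; rewrite subr_eq0 gt_eqF.
have du n : bounded_by (u n.+1 - u n) (q n.+1 - q n).
  rewrite dq; elim: n => [|n IH].
    rewrite /u /= mulr0 addr0 subr0 expr0 -(rmorph1 sc); exact: bounded_byC.
  have -> : u n.+2 - u n.+1 = z * (u n.+1 - u n) by rewrite /u /=; ring.
  by rewrite exprS; apply: bounded_byM; rewrite ?exprn_ge0// ltW.
have qS n : q n <= q n.+1 by rewrite -subr_ge0 dq exprn_ge0// ltW.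
have qM n : q n <= 1 / (1 - k).
  by rewrite ler_pM2r ?invr_gt0 ?subr_gt0// gerBl exprn_ge0// ltW.
have [t ut] := dominated_cvg complB qS qM du.
exists t; apply/eqP; rewrite -subr_eq0; apply/eqP.
apply: bounded_by_eq0 => e e0.
have e2 : 0 < e / 2 by lra.
have [n [H1 H2]] := cvg_shift e2 ut.
have := bounded_byB (bounded_byM (ltW k0) (ltW e2) zk H1) H2.
have -> : z * (u n - t) - (u n.+1 - t) = (1 - z) * t - 1 by rewrite /u /=; ring.
by apply: bounded_by_le; nra.
Qed.

(** For large [m] the element [z = 1 - x / m] is bounded by [1 - e / m < 1], and [x = m (1 - z)]. *)
Lemma inv_bounded x e l : cone_complete -> 0 < e ->
  pos (x - sc e) -> pos (sc l - x) -> exists t, x * t = 1.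
Proof.
move=> complB e0 xe xl.
(* No sign of [l] is given; this [m] exceeds both [l] and [e], which makes [0 < 1 - e / m < 1]. *)
pose m := `|l| + e + 1.
have m0 : 0 < m by rewrite /m; have := normr_ge0 l; lra.
have em : e < m by rewrite /m; have := normr_ge0 l; lra.
have lm : l <= m by rewrite /m; have := ler_norm l; lra.
have mV : m^-1 * m = 1 by rewrite mulVf// gt_eqF.
have smV : sc m^-1 * sc m = 1 by rewrite -rmorphM mV rmorph1.
have mV0 : 0 <= m^-1 by rewrite invr_ge0 ltW.
have k0 : 0 < 1 - e / m by rewrite subr_gt0 ltr_pdivrMr// mul1r.
have k1 : 1 - e / m < 1 by rewrite ltrBlDr ltrDl divr_gt0.
have xm : pos (sc m - x).
  have := coneD K xl (coneC (_ : 0 <= m - l)); rewrite subr_ge0 => /(_ lm).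
  by congr pos; ring.
have zk : bounded_by (1 - sc m^-1 * x) (1 - e / m).
  split; first by have := coneZ mV0 xe; congr pos; ring.
  have := coneD K (coneZ mV0 xm) (coneC (ltW k0)); congr pos.
  ring: smV.
have [t] := neumann complB k0 k1 zk.
by rewrite subKr -mulrA mulrCA => H; exists (sc m^-1 * t).
Qed.

(* [1 - sqrt x] is the fixed point of [y |-> (1 - x + y^2) / 2]; the same
   iteration over the reals at [x = 0] dominates its increments. *)
Lemma sqrt_le1 x : cone_complete -> pos x -> pos (1 - x) ->
  exists y, pos y /\ y ^+ 2 = x.
Proof.
move=> complB x0 x1.
pose u n := iter n (fun y => sc 2^-1 * (1 - x + y ^+ 2)) 0.
pose q n : R := iter n (fun r => 2^-1 * (1 + r ^+ 2)) 0.
have s2 : sc 2^-1 * 2 = 1.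
  by rewrite -(rmorph_nat sc) -rmorphM mulVf// rmorph1.
have q01 n : 0 <= q n <= 1.
  by elim: n => [|n /andP[H1 H2]]; rewrite /q /=; [lra|rewrite -/(q n); nra].
have dq n : q n.+1 - q n = 2^-1 * (1 - q n) ^+ 2.
  by rewrite /q /= -/(q n); field.
have qS n : q n <= q n.+1.
  by rewrite -subr_ge0 dq mulr_ge0// ?sqr_ge0//; lra.
have qM n : q n <= 1 by have /andP[] := q01 n.
have zB : bounded_by (1 - x) 1.
  split; rewrite rmorph1; last exact: (coneD K (cone1 K) x1).
  by rewrite subKr.
have uB n : bounded_by (u n) (q n).
  elim: n => [|n IH]; first exact: bounded_by00.
  have /andP[q0 _] := q01 n.
  apply: bounded_byZ; [nra|lra|].
  apply: bounded_byD => //; rewrite !expr2.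
  by apply: bounded_byM.
have du n : bounded_by (u n.+1 - u n) (q n.+1 - q n).
  elim: n => [|n IH].
    rewrite /u /q /= !subr0 !expr0n/= !addr0.
    by apply: bounded_byZ; rewrite ?ler01 ?invr_ge0.
  (* The increment factors into a difference and a sum, each dominated by its real counterpart. *)
  have -> : u n.+2 - u n.+1 = sc 2^-1 * ((u n.+1 - u n) * (u n.+1 + u n)).
    by rewrite /u /=; ring.
  have -> : q n.+2 - q n.+1 = 2^-1 * ((q n.+1 - q n) * (q n.+1 + q n)).
    by rewrite /q /=; ring.
  have /andP[? _] := q01 n; have /andP[? _] := q01 n.+1; have ? := qS n.
  apply: bounded_byZ; [nra|lra|].
  by apply: bounded_byM => //; [lra|lra|apply: bounded_byD].
have [y uy] := dominated_cvg complB qS qM du.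
have y1 : bounded_by y 1.
  apply: bounded_by_arch => e e0; have [N /(_ N (leqnn N)) H] := uy e e0.
  have := bounded_byB (bounded_by_le (qM N) (uB N)) H.
  by rewrite subKr.
(* Limit of the recursion: [u n ^+ 2 - y ^+ 2] is [u n - y] times [u n + y], and the second factor
   is bounded by [2]. *)
have yE : sc 2^-1 * (1 - x + y ^+ 2) - y = 0.
  apply: bounded_by_eq0 => e e0.
  have e2 : 0 < e / 2 by lra.
  have [n [H1 H2]] := cvg_shift e2 uy.
  have H3 := bounded_byD (bounded_by_le (qM n) (uB n)) y1.
  have H4 := bounded_byM (ltW e2) (addr_ge0 ler01 ler01) H1 H3.
  have h0 : 0 <= 2^-1 :> R by lra.
  have e22 : 0 <= e / 2 * (1 + 1) by lra.
  have := bounded_byB H2 (bounded_byZ e22 h0 H4).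
  have -> : u n.+1 - y - sc 2^-1 * ((u n - y) * (u n + y)) =
            sc 2^-1 * (1 - x + y ^+ 2) - y by rewrite /u /=; ring.
  by apply: bounded_by_le; lra.
exists (1 - y); split; first by have [] := y1; rewrite rmorph1.
have -> : (1 - y) ^+ 2 = x + (1 - x + y ^+ 2) - 2 * y by ring.
have -> : 2 * y = sc 2^-1 * 2 * (1 - x + y ^+ 2).
  by rewrite -[y in LHS]addr0 -yE; ring.
by rewrite s2; ring.
Qed.

Lemma sqrt_bounded x l : cone_complete -> 0 < l -> pos x -> pos (sc l - x) ->
  exists y, pos y /\ y ^+ 2 = x.
Proof.
move=> complB l0 x0 xl.
have lV0 : 0 <= l^-1 by rewrite invr_ge0 ltW.
have slV : sc l^-1 * sc l = 1 by rewrite -rmorphM mulVf ?rmorph1// gt_eqF.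
have [|y [y0 yE]] := @sqrt_le1 (sc l^-1 * x) complB (coneZ lV0 x0).
  by have := coneZ lV0 xl; rewrite mulrBr slV.
exists (sc (Num.sqrt l) * y); split; first exact: coneZ (sqrtr_ge0 _) y0.
rewrite exprMn yE -rmorphXn sqr_sqrtr ?ltW// mulrA.
by rewrite [sc l * _]mulrC slV mul1r.
Qed.

(** * Inverses and square roots of unbounded elements *)

(** Since [a] may be unbounded, [inv_bounded] is applied to [1 - s = a^2 s]; its inverse [t] makes
    [a s t] an inverse of [a]. *)
Lemma resolvent_inv a s e : cone_complete ->
  (a ^+ 2 + 1) * s = 1 -> 0 < e -> pos (a - sc e) -> exists t, a * t = 1.
Proof.
move=> complB sE e0 ae.
have as1 : a ^+ 2 * s = 1 - s by rewrite -sE; ring.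
have ae2 : pos (a ^+ 2 - sc (e ^+ 2)).
  have := coneD K (cone_sqr (a - sc e)) (coneZ (ltW _ : 0 <= 2 * e) ae).
  by rewrite mulr_gt0// => /(_ isT); congr pos; ring.
have s0 : pos s.
  have := cone_sqrM K s (coneD K (cone_sqr a) (cone1 K)); congr pos.
  by rewrite expr2 -mulrA [s * (_ + _)]mulrC sE mulr1.
(* [s^2 (a^2 + 1) (a^2 - e^2) = s (a^2 - e^2) = 1 - (1 + e^2) s], hence
   [1 - s >= e^2 / (1 + e^2)]. *)
have s1 : pos (1 - sc (1 + e ^+ 2) * s).
  have := cone_sqrM K s (coneD K (cone_sqrM K a ae2) ae2); congr pos.
  by ring: as1.
have e1 : 0 < 1 + e ^+ 2 by have := sqr_ge0 e; lra.
have [||| t tE] := @inv_bounded (1 - s) (e ^+ 2 / (1 + e ^+ 2)) 1 complB.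
- by rewrite divr_gt0// exprn_gt0.
- apply: (coneZK e1); move: s1; congr pos.
  rewrite !mulrBr -rmorphM mulrCA divff ?gt_eqF//; ring.
- by rewrite rmorph1 subKr.
by exists (a * s * t); rewrite !mulrA -expr2 as1.
Qed.

(** Cancelling [a] means multiplying by [t = a^-1], which the cone allows once [t] is a square; as
    [0 <= t <= e^-1], a bounded square root suffices. *)
Lemma symmetric_radical : cone_complete -> cone_symmetric -> cone_radical.
Proof.
move=> complB symB a b e e0 ae ab0.
have [t at1] := symB a e e0 ae.
have a0 : pos a by have := coneD K ae (coneC (ltW e0)); rewrite subrK.
have t0 : pos t.
  by have := cone_sqrM K t a0; congr pos; ring: at1.
(* [t^2 ((a - e)^2 + e (a - e)) = t^2 a (a - e) = 1 - e t]. *)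
have et1 : pos (1 - sc e * t).
  have := cone_sqrM K t (coneD K (cone_sqr (a - sc e)) (coneZ (ltW e0) ae)).
  by congr pos; ring: at1.
have [|| s [s0 sE]] := @sqrt_bounded t e^-1 complB _ t0.
- by rewrite invr_gt0.
- have e0' : 0 <= e^-1 by rewrite invr_ge0 ltW.
  have := coneZ e0' et1; rewrite mulrBr mulr1 mulrA -rmorphM mulVf ?gt_eqF//.
  by rewrite rmorph1 mul1r.
have := cone_sqrM K s ab0; congr pos.
by rewrite sE mulrA -[t * a]mulrC at1 mul1r.
Qed.

(** With [t = (a + 1)^-1] both [t] and [1 - t] lie between [0] and [1], and
    [a = (1 - t) t (a + 1)^2]. *)
Lemma symmetric_sqrt a : cone_complete -> cone_symmetric -> pos a ->
  exists y, pos y /\ y ^+ 2 = a.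
Proof.
move=> complB symB a0.
have [|t] := symB (a + 1) 1 ltr01; first by rewrite rmorph1 addrK.
move=> tE; have at1 : a * t = 1 - t by rewrite -tE; ring.
have t0 : pos t.
  by have := cone_sqrM K t (coneD K a0 (cone1 K)); congr pos; ring: at1.
have t1 : pos (1 - t).
  have := cone_sqrM K t (coneD K (cone_sqr a) a0); congr pos.
  by ring: at1.
have [r [r0 rE]] := sqrt_le1 complB t0 t1.
have [|q [q0 qE]] := sqrt_le1 complB t1; first by rewrite subKr.
(* [2 (1 - q) = t + (1 - q)^2]. Thus [q <= 1] has a square root [p] in turn, and multiplication by
   [q = p^2] preserves the cone. *)
have q1 : pos (1 - q).
  apply: (@coneZK 2) => //; have := coneD K t0 (cone_sqr (1 - q)); congr pos.
  have -> : t = 1 - q ^+ 2 by rewrite qE subKr.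
  by ring.
have [p [p0 pE]] := sqrt_le1 complB q0 q1.
exists (q * (r * (a + 1))); split.
  rewrite -pE; apply: (cone_sqrM K).
  have := cone_sqrM K (r * (a + 1)) r0; congr pos.
  have -> : (r * (a + 1)) ^+ 2 * r = r ^+ 2 * (a + 1) * (r * (a + 1)) by ring.
  by rewrite rE -[t * _]mulrC tE mul1r.
rewrite !exprMn qE rE.
have -> : (1 - t) * (t * (a + 1) ^+ 2) =
  (a + 1) * t * ((a + 1) - (a + 1) * t) by ring.
by rewrite tE mul1r addrK.
Qed.

(* The product [(s + e) (u + e)] is at least [u^2 + e u + e^2 >= 0]. *)
Lemma radical_pos s u : cone_radical ->
  pos s -> pos (s * u - u ^+ 2) -> pos u.
Proof.
move=> radB s0 H; apply: (cone_arch K) 1 _ => e e0.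
rewrite mulr1; apply: (radB (s + sc e) _ e e0); first by rewrite addrK.
(* [4 (s + e) (u + e) = 4 (s u - u^2) + 4 e s + (2 u + e)^2 + 3 e^2]. *)
apply: (@coneZK 4) => //.
have e2 : 0 <= 3 * e ^+ 2 by rewrite mulr_ge0// sqr_ge0.
have := coneD K (coneD K (coneMn 4 H) (coneZ (ltW _ : 0 <= 4 * e) s0))
  (coneD K (cone_sqr (2 * u + sc e)) (coneC e2)).
by rewrite mulr_gt0// => /(_ isT); congr pos; ring.
Qed.

Lemma sqr_eq0 x : x ^+ 2 = 0 -> x = 0.
Proof.
move=> x2; apply: bounded_by_eq0 => e e0; apply/bounded_by_sqr => //.
by rewrite x2 subr0; apply: coneC; exact: sqr_ge0.
Qed.


(** * Meets in a radical cone and the inverse as a limit *)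

Definition cone_meet a b x : Prop :=
  pos (a + b - x *+ 2) /\ x ^+ 2 + a * b = x * (a + b).

(** The meet equation says that [b - x] and [a - x] have product [0]. Their sum [s] is positive, and
    [s u - u^2 = 0] for [u] either of them, so [radical_pos] applies. *)
Lemma cone_meet_pos a b x : cone_radical -> cone_meet a b x ->
  [/\ (b - x) * (a - x) = 0, pos (b - x) & pos (a - x)].
Proof.
move=> radB [H1 H2].
have H0 : (b - x) * (a - x) = 0.
  have -> : (b - x) * (a - x) = x ^+ 2 + a * b - x * (a + b) by ring.
  by rewrite H2 subrr.
have H3 : pos ((b - x) + (a - x)) by move: H1; congr pos; ring.
split=> //; apply: (radical_pos radB H3).
  have -> : ((b - x) + (a - x)) * (b - x) - (b - x) ^+ 2 =
    (b - x) * (a - x) by ring.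
  by rewrite H0; exact: cone0.
have -> : ((b - x) + (a - x)) * (a - x) - (a - x) ^+ 2 =
  (b - x) * (a - x) by ring.
by rewrite H0; exact: cone0.
Qed.

(** For [u = x - 1] and [s = (l - 1) + (c - 1)] the meet equation becomes
    [s u - u^2 = (l - 1) (c - 1)]. *)
Lemma cone_meet_ge1 c l x : cone_radical -> 1 <= l -> pos (c - 1) ->
  cone_meet c (sc l) x -> pos (x - 1).
Proof.
move=> radB l1 c1 [_ H2].
have l10 : 0 <= l - 1 by rewrite subr_ge0.
apply: (radical_pos radB (coneD K (coneC l10) c1)).
have := coneZ l10 c1; congr pos.
have -> : (x - 1) ^+ 2 = x ^+ 2 - 2 * x + 1 by ring.
have -> : x ^+ 2 = x * (c + sc l) - c * sc l by rewrite -H2 addrK.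
ring.
Qed.

(* Pointwise, [x = min (c, l)] and [y = min (c, k)] differ only where [x = l],
   and there [1 / x - 1 / y] lies between [0] and [1 / l]. *)
Lemma inv_meet_close c l k x y s t : cone_radical -> 0 < l -> l < k ->
  cone_meet c (sc l) x -> cone_meet c (sc k) y ->
  pos (x - 1) -> pos (y - 1) -> x * s = 1 -> y * t = 1 ->
  bounded_by (s - t) l^-1.
Proof.
move=> radB l0 lk /(cone_meet_pos radB)[fq f0 q0].
move=> /(cone_meet_pos radB)[jh j0 h0] x1 y1 xs yt.
have rad1 a b : pos (a - 1) -> pos (a * b) -> pos b.
  by move=> a1; apply: (radB _ _ 1) => //; rewrite rmorph1.
set f := sc l - x in fq f0; set q := c - x in fq q0.
set j := sc k - y in jh j0; set h := c - y in jh h0.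
have kl0 : 0 < k - l by rewrite subr_gt0.
(* [(f h)^2 ((k - l) + f + h) = (f h)^2 (j + q) = 0] is a sum of three
   positive elements. *)
have fh : f * h = 0.
  apply: sqr_eq0; apply: (cone_anti K).
    exact: cone_sqr.
  apply: (coneZK kl0); have := cone_sqrM K (f * h) (coneD K f0 h0); congr pos.
  have : f * h * (f * h) * (j + q) = 0.
    have -> : f * h * (f * h) * (j + q) =
      f * f * h * (j * h) + f * h * h * (f * q) by ring.
    by rewrite fq jh !mulr0 addr0.
  move=> E; rewrite -[LHS]subr0 -E /f /h /j /q; ring.
have gE : y - x = q - h by rewrite /q /h; ring.
(* [q (y - x) - (y - x)^2 = h (y - x) = (k - l) h], because [f h] and [j h] vanish. *)
have g0 : pos (y - x).
  apply: (radical_pos radB q0); have := coneZ (ltW kl0) h0; congr pos.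
  have -> : q * (y - x) - (y - x) ^+ 2 = sc (k - l) * h + f * h - j * h.
    by rewrite /q /h /f /j; ring.
  by rewrite fh jh subr0 addr0.
have eE : s - t = s * t * (y - x).
  have -> : s * t * (y - x) = s * (y * t) - t * (x * s) by ring.
  by rewrite xs yt !mulr1.
have e0 : pos (s - t).
  apply: (rad1 x _ x1); apply: (rad1 y _ y1); move: g0; congr pos.
  have -> : y * (x * (s - t)) = y * (x * s) - x * (y * t) by ring.
  by rewrite xs yt !mulr1.
have fe : f * (s - t) = 0.
  have -> : f * (s - t) = s * t * (f * q - f * h) by rewrite eE gE; ring.
  by rewrite fq fh subrr mulr0.
(* Since [f (s - t) = 0], the element [x] acts as [l] on [s - t], and so its inverse [s] acts as
   [l^-1]. *)
have se : s * (s - t) = sc l^-1 * (s - t).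
  have : sc l * (s * (s - t)) = s - t.
    have -> : sc l * (s * (s - t)) = s * (f * (s - t)) + x * s * (s - t).
      by rewrite /f; ring.
    by rewrite fe xs mulr0 add0r mul1r.
  by move=> {2}<-; rewrite [RHS]mulrA -rmorphM mulVf ?gt_eqF// rmorph1 mul1r.
have et0 : pos ((s - t) * t).
  by apply: (rad1 y _ y1); rewrite mulrCA yt mulr1.
have l0V : 0 <= l^-1 by rewrite invr_ge0 ltW.
split; last exact: (coneD K (coneC l0V) e0).
(* For [u = l^-1 - (s - t)] one has [l^-1 u - u^2 = (s - t) t]. *)
apply: (radical_pos radB (coneC l0V)); move: et0; congr pos.
have -> : sc l^-1 * (sc l^-1 - (s - t)) - (sc l^-1 - (s - t)) ^+ 2 =
  sc l^-1 * (s - t) - (s - t) ^+ 2 by ring.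
by rewrite -se; ring.
Qed.

Lemma radical_meet_inv c : cone_complete -> cone_radical -> pos (c - 1) ->
  (forall n : nat, exists x, cone_meet c (sc n.+1%:R) x) ->
  exists t, c * t = 1.
Proof.
move=> complB radB c1 /boolp.choice[x xP].
have nV0 n : 0 < n.+1%:R^-1 :> R by rewrite invr_gt0.
have x1 n : pos (x n - 1).
  by apply: cone_meet_ge1 (xP n) => //; rewrite ler1n.
have /boolp.choice[t tP] n : exists t, x n * t = 1.
  have [_ H _] := cone_meet_pos radB (xP n).
  by apply: (@inv_bounded (x n) 1 n.+1%:R) => //; rewrite rmorph1.
have tB (m n : nat) : (n <= m)%N -> bounded_by (t n - t m) n.+1%:R^-1.
  rewrite leq_eqVlt => /predU1P[->|nm].
    by rewrite subrr -(rmorph0 sc); apply: bounded_by_le (bounded_byC _).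
  by apply: inv_meet_close (xP n) (xP m) _ _ _ _; rewrite ?ltr_nat.
have small e : 0 < e ->
    exists N : nat, forall n : nat, (N <= n)%N -> n.+1%:R^-1 <= e.
  move=> e0; have eV0 : 0 < e^-1 by rewrite invr_gt0.
  exists (Num.bound e^-1) => n Nn; rewrite invf_ple ?posrE ?ltr0n//.
  by rewrite ltW// (lt_le_trans (archi_boundP (ltW eV0)))// ler_nat leqW.
have [z tz] : exists z, cone_cvg t z.
  apply: complB => e /small[N HN]; exists N => m n Nm Nn.
  case/orP: (leq_total m n) => mn.
    by apply: bounded_by_le (HN _ Nm) (tB _ _ mn).
  by apply: bounded_byBC; apply: bounded_by_le (HN _ Nn) (tB _ _ mn).
exists z; apply/eqP; rewrite -subr_eq0; apply/eqP.
have c0 : pos c by have := coneD K c1 (cone1 K); rewrite subrK.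
have c21 : pos (c ^+ 2 + 1) by apply: (coneD K) (cone_sqr _) (cone1 K).
(* Multiplication by [c] need not be continuous, so [c z - 1] is compared with a multiple of
   [c^2 + 1 + c]: the part [c^2 + 1] absorbs [c d], and [c] absorbs [r (c - x n)]. *)
apply: (@arch_eq0 _ (c ^+ 2 + 1 + c)) => e e0.
have [N1 HN1] := small e e0; have [N2 HN2] := tz e e0.
pose n := maxn N1 N2.
have /HN1 ne : (N1 <= n)%N by rewrite leq_maxl.
have /HN2 /(bounded_by_sqr _ e0) : (N2 <= n)%N by rewrite leq_maxr.
set d := t n - z => d2.
have [H1 H2 q0] := cone_meet_pos radB (xP n).
set l := sc n.+1%:R in H1 H2 *; pose r := sc n.+1%:R^-1.
have rl : r * l = 1 by rewrite -rmorphM mulVf ?rmorph1// pnatr_eq0.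
(* [t n] acts as [r] on [c - x n], because [(l - x n) (c - x n) = 0]. *)
have ctE : c * t n - 1 = r * (c - x n).
  have -> : c * t n - 1 = (r * l) * (c * t n - x n * t n).
    by rewrite rl tP mul1r.
  have -> : r * l * (c * t n - x n * t n) = 
    r * (x n * t n * (c - x n) + t n * ((l - x n) * (c - x n))) by ring.
  by rewrite H1 tP mulr0 addr0 mul1r.
have x0 : pos (x n) by have := coneD K (x1 n) (cone1 K); rewrite subrK.
(* [c] may be unbounded, so [c d] is controlled through [(e c +- d)^2 >= 0]. *)
have cd1 : pos (sc e * (c ^+ 2 + 1) - c * d *+ 2).
  apply: (coneZK e0); have := coneD K (cone_sqr (sc e * c - d)) d2.
  by congr pos; ring.
have cd2 : pos (sc e * (c ^+ 2 + 1) + c * d *+ 2).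
  apply: (coneZK e0); have := coneD K (cone_sqr (sc e * c + d)) d2.
  by congr pos; ring.
have czE : c * z - 1 = r * (c - x n) - c * d by rewrite -ctE /d; ring.
have rq0 : pos (r * (c - x n)) by apply: coneZ => //; exact: ltW.
have rx0 : pos (r * x n) by apply: coneZ => //; exact: ltW.
have ec0 : pos (sc e * (c ^+ 2 + 1)) by apply: coneZ => //; exact: ltW.
have erc : pos ((sc e - r) * c).
  by rewrite -rmorphB; apply: coneZ => //; rewrite subr_ge0.
have er0 : pos (sc e * c) by apply: coneZ => //; exact: ltW.
split; apply: (@coneZK 2) => //; rewrite czE.
  have := coneD K (coneD K ec0 cd2) (coneMn 2 (coneD K erc rx0)).
  by congr pos; ring.
have := coneD K (coneD K ec0 cd1) (coneMn 2 (coneD K er0 rq0)).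
by congr pos; ring.
Qed.

End ArchimedeanCone.

(** * Uniform limits in ordered *-algebras *)

Section StarAlgebraFacts.
Variables (R : realType) (A : starAlgType R).
Implicit Types (a b d t x : A) (z : R[i]) (S : set A).

(** Turns scaling into multiplication by central elements, so that the lemmas on ring morphisms
    apply. *)
Definition cscalar z : A := z **: 1.

Lemma scaleE z a : z **: a = cscalar z * a.
Proof. by rewrite /cscalar -star_scaleAl mul1r. Qed.

Lemma cscalarC z a : cscalar z * a = a * cscalar z.
Proof. by rewrite /cscalar -star_scaleAl -star_scaleAr mul1r mulr1. Qed.

Lemma cscalar_is_zmod : zmod_morphism cscalar.
Proof.
by move=> y z; apply/eqP; rewrite eq_sym subr_eq -star_scaleDl subrK.
Qed.

Lemma cscalar_is_monoid : monoid_morphism cscalar.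
Proof.
split; first exact: star_scale1.
by move=> y z; rewrite {1}/cscalar -star_scaleA scaleE.
Qed.

HB.instance Definition _ :=
  GRing.isZmodMorphism.Build R[i] A cscalar cscalar_is_zmod.
HB.instance Definition _ :=
  GRing.isMonoidMorphism.Build R[i] A cscalar cscalar_is_monoid.

Lemma star0 : star (0 : A) = 0.
Proof. by apply: (addrI (star (0 : A))); rewrite -starD !addr0. Qed.

Lemma starN a : star (- a) = - star a.
Proof. by apply: (addrI (star a)); rewrite -starD !subrr star0. Qed.

Lemma starB a b : star (a - b) = star a - star b.
Proof. by rewrite starD starN. Qed.

Lemma star1 : star (1 : A) = 1.
Proof. by rewrite -[LHS]mulr1 -{2}[1]starK -starM mulr1 starK. Qed.

Definition imag : A := cscalar (0 +i* 1).

Lemma imagM : imag * imag = - 1.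
Proof.
by rewrite -rmorphM -(rmorph1 cscalar) -rmorphN; congr cscalar; simpc.
Qed.

Lemma imagC a : imag * a = a * imag. Proof. exact: cscalarC. Qed.

Lemma imag_eq0 a : imag * a = 0 -> a = 0.
Proof.
move/(congr1 ( *%R imag)); rewrite mulrA imagM mulr0 mulN1r => /eqP.
by rewrite oppr_eq0 => /eqP.
Qed.

Lemma star_cscalar z : star (cscalar z) = cscalar (conjc z).
Proof. by rewrite /cscalar starZ star1. Qed.

Lemma star_imag : star imag = - imag.
Proof. by rewrite star_cscalar -rmorphN; congr cscalar; simpc. Qed.

Lemma cscalar_eq0 z a : z != 0 -> cscalar z * a = 0 -> a = 0.
Proof.
move=> z0 H; rewrite -[a]mul1r -(rmorph1 cscalar) -(mulVf z0) rmorphM -mulrA H.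
by rewrite mulr0.
Qed.

Definition rscalar (r : R) : A := cscalar r%:C.

Lemma rscalar_is_zmod : zmod_morphism rscalar.
Proof. by move=> y z; rewrite /rscalar !rmorphB. Qed.

Lemma rscalar_is_monoid : monoid_morphism rscalar.
Proof. by split=> [|y z]; rewrite /rscalar ?rmorph1 ?rmorphM. Qed.

HB.instance Definition _ :=
  GRing.isZmodMorphism.Build R A rscalar rscalar_is_zmod.
HB.instance Definition _ :=
  GRing.isMonoidMorphism.Build R A rscalar rscalar_is_monoid.

Lemma rscalarE r a : r%:C **: a = rscalar r * a.
Proof. exact: scaleE. Qed.

Lemma rscalarC r a : rscalar r * a = a * rscalar r.
Proof. exact: cscalarC. Qed.

Lemma herm_rscalar r : is_herm (rscalar r).
Proof. by rewrite /is_herm /= star_cscalar conjc_real. Qed.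

Lemma hermD a b : is_herm a -> is_herm b -> is_herm (a + b).
Proof. by rewrite /is_herm /= starD => -> ->. Qed.

Lemma hermN a : is_herm a -> is_herm (- a).
Proof. by rewrite /is_herm /= starN => ->. Qed.

Lemma hermB a b : is_herm a -> is_herm b -> is_herm (a - b).
Proof. by move=> Ha /hermN; apply: hermD. Qed.

Lemma hermM a b : is_herm a -> is_herm b -> GRing.comm a b -> is_herm (a * b).
Proof. by rewrite /is_herm /= starM => -> -> ->. Qed.

Lemma herm1 : is_herm (1 : A). Proof. exact: star1. Qed.

End StarAlgebraFacts.

Section OrderedFacts.
Variables (R : realType) (A : orderedStarAlgType R).
Implicit Types (a b d t x : A) (z : R[i]) (r e : R) (S : set A).

(** * Commutants and the positive cone *)

Lemma commutant_star S t : (forall s, S s -> is_herm s) ->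
  commutant S t -> commutant S (star t).
Proof.
move=> HS Ht s Ss; have /(congr1 star) := Ht s Ss.
by rewrite !starM (HS s Ss).
Qed.

Lemma sub_commutant S1 S2 : S1 `<=` S2 -> commutant S2 `<=` commutant S1.
Proof. by move=> H t Ht s /H; apply: Ht. Qed.

Lemma sub_bicommutant S1 S2 : commutant S1 `<=` commutant S2 ->
  bicommutant S2 `<=` bicommutant S1.
Proof. exact: sub_commutant. Qed.

Lemma hle_hpos a b : is_herm a -> (a <=h b) <-> hpos (b - a).
Proof.
move=> Ha; split=> [ab|]; rewrite /hpos /=.
  by have := hle_add _ _ _ (hermN Ha) ab; rewrite subrr.
by move=> /(hle_add _ _ _ Ha); rewrite add0r subrK.
Qed.

Lemma hpos_herm a : hpos a -> is_herm a.
Proof. by move=> /(hle_herm _ _)[]. Qed.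

Lemma hposD a b : hpos a -> hpos b -> hpos (a + b).
Proof.
move=> Ha Hb; apply: (hle_trans _ _ _ Hb); rewrite -{1}[b]add0r.
exact: hle_add _ _ _ (hpos_herm Hb) Ha.
Qed.

Lemma hpos_conj d a : hpos a -> hpos (star d * a * d).
Proof. by move=> /(hle_conj _ _ d); rewrite mulr0 mul0r. Qed.

Lemma hpos1 : hpos (1 : A). Proof. exact: hle_01. Qed.

Lemma hpos_star_mul d : hpos (star d * d).
Proof. by have := hpos_conj d hpos1; rewrite mulr1. Qed.

Lemma hposZ r a : 0 <= r -> hpos a -> hpos (rscalar A r * a).
Proof.
move=> r0 Ha; have := hpos_conj (rscalar A (Num.sqrt r)) Ha.
by rewrite (herm_rscalar A) -mulrA -rscalarC mulrA -rmorphM -expr2 sqr_sqrtr.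
Qed.

Lemma hposZK r a : 0 < r -> hpos (rscalar A r * a) -> hpos a.
Proof.
move=> r0 H; have rV0 : 0 <= r^-1 by rewrite invr_ge0 ltW.
by have := hposZ rV0 H; rewrite mulrA -rmorphM mulVf ?gt_eqF// rmorph1 mul1r.
Qed.

Lemma hpos_rscalar r : 0 <= r -> hpos (rscalar A r).
Proof. by move=> r0; rewrite -[rscalar A r]mulr1; exact: hposZ hpos1. Qed.

Lemma hpos_anti a : hpos a -> hpos (- a) -> a = 0.
Proof.
move=> Ha Hna; apply: hle_anti; last exact: Ha.
by apply/hle_hpos; [exact: hpos_herm|rewrite sub0r].
Qed.

Lemma hpos_arch a w : archimedean_alg A -> is_herm a -> is_herm w ->
  (forall e, 0 < e -> hpos (a + rscalar A e * w)) -> hpos a.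
Proof.
move=> archA Ha Hw H.
have /hle_hpos : - a <=h 0.
  apply: archA (hermN Ha) Hw _ => e e0; apply/hle_hpos; first exact: hermN.
  by rewrite opprK rscalarE addrC; exact: H.
by rewrite sub0r opprK; apply; exact: hermN.
Qed.

Lemma herm_eq0 a w : archimedean_alg A -> is_herm a -> is_herm w ->
  (forall e, 0 < e ->
     hpos (a + rscalar A e * w) /\ hpos (- a + rscalar A e * w)) -> a = 0.
Proof.
move=> archA Ha Hw H; apply: hpos_anti; apply: hpos_arch archA _ Hw _ => //.
- by move=> e /H[].
- exact: hermN.
- by move=> e /H[].
Qed.

(** Avoids infima and extended reals: it follows from [unorm a < e] and, for [e > 0], implies
    [unorm a <= e]. *)
Definition norm_le a e : Prop := hpos (rscalar A (e ^+ 2) - star a * a).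

Lemma norm_leP a e : norm_le a e <-> star a * a <=h (e ^+ 2)%:C **: 1.
Proof.
have Ha := hpos_herm (hpos_star_mul a).
by split=> [H|/hle_hpos]; [apply/hle_hpos|exact].
Qed.

Lemma norm_le_le a e1 e2 : 0 <= e1 -> e1 <= e2 -> norm_le a e1 -> norm_le a e2.
Proof.
move=> e10 e12 H; have e0 : 0 <= e2 ^+ 2 - e1 ^+ 2 by nra.
have := hposD H (hpos_rscalar e0).
by rewrite /norm_le rmorphB addrC addrA subrK.
Qed.

Lemma unorm_lt_norm_le a e : (unorm a < e%:E)%E -> norm_le a e.
Proof.
move=> /ereal_inf_lt[_ [l [l0 /norm_leP H] <-]]; rewrite lte_fin => le.
exact: norm_le_le (ltW l0) (ltW le) H.
Qed.

Lemma norm_le_unorm a e : 0 < e -> norm_le a e -> (unorm a <= e%:E)%E.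
Proof.
by move=> e0 /norm_leP H; apply: ereal_inf_lbound; exists e.
Qed.

Lemma norm_complete (u : nat -> A) : uniformly_complete A ->
  (forall e, 0 < e -> exists N : nat, forall m n : nat,
     (N <= m)%N -> (N <= n)%N -> norm_le (u m - u n) e) ->
  exists x, forall e, 0 < e -> exists N : nat, forall n : nat,
     (N <= n)%N -> norm_le (u n - x) e.
Proof.
move=> complA cu; have [e e0|x ux] := complA u.
  (* Halving [e] recovers the strict inequality required by [ucauchy]. *)
  have [|N HN] := cu (e / 2); first by rewrite divr_gt0.
  exists N => m n Nm Nn; rewrite /udist gt_min; apply/orP; left.
  apply: le_lt_trans (norm_le_unorm _ (HN m n Nm Nn)) _.
    by rewrite divr_gt0.
  by rewrite lte_fin ltr_pdivrMr// ltr_pMr// ltr1n.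
(* [udist] is truncated at [1]; only below [1] does it control [unorm]. *)
exists x => e e0; have [|N HN] := ux (Num.min e 1).
  by rewrite lt_min e0 ltr01.
exists N => n /HN; rewrite /udist gt_min => /orP[/unorm_lt_norm_le|].
  by apply: norm_le_le; rewrite ?ge_min ?lexx// le_min ler01 ltW.
by rewrite lte_fin lt_min ltxx andbF.
Qed.

(** * Order estimates from norm bounds, and limits *)

Lemma norm_le_herm x e : is_herm x -> norm_le x e <->
  hpos (rscalar A (e ^+ 2) - x * x).
Proof. by move=> Hx; rewrite /norm_le Hx. Qed.

Lemma norm_le_imul a e : norm_le a e -> norm_le (imag A * a) e.
Proof.
rewrite /norm_le starM star_imag mulrN mulNr mulrA.
by rewrite -[star a * imag A * imag A]mulrA imagM mulrN1 mulNr opprK.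
Qed.

Lemma norm_leN a e : norm_le a e -> norm_le (- a) e.
Proof. by rewrite /norm_le starN mulrNN. Qed.

(** Add [(e + d)^* (e + d) >= 0] to [e^2 - d^* d >= 0] and divide by [e]. *)
Lemma hpos_real_part d e : 0 < e -> norm_le d e ->
  hpos (d + star d + rscalar A e * 2).
Proof.
move=> e0 de; apply: (hposZK e0).
have := hposD (hpos_star_mul (rscalar A e + d)) de; congr hpos.
rewrite starD (herm_rscalar A) rmorphXn expr2 mulrDl !mulrDr.
rewrite -(rscalarC e (star d)).
by rewrite addrACA addrK [X in X + _ + _]addrC -[X in X + _]addrA addrAC mulr1.
Qed.

(* Expand [(x + i y)^* (x + i y)]. *)
Lemma hpos_commutator x y : is_herm x -> is_herm y ->
  hpos (x * x + y * y + imag A * (x * y - y * x)).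
Proof.
move=> Hx Hy; have := hpos_star_mul (x + imag A * y); congr hpos.
rewrite starD starM Hx Hy star_imag mulrDl !mulrDr.
have -> : x * (imag A * y) = imag A * (x * y) by rewrite mulrA -imagC mulrA.
have -> : y * - imag A * x = - (imag A * (y * x)).
  by rewrite mulrN mulNr -imagC mulrA.
have -> : y * - imag A * (imag A * y) = y * y.
  rewrite mulrN mulNr mulrA -[y * imag A * imag A]mulrA imagM.
  by rewrite mulrN1 mulNr opprK.
by rewrite mulrN [- _ + _]addrC addrACA.
Qed.

(** With [d = u - x] the Hermitian element [h = i (x^* - x)] is [i d] plus its adjoint, so it lies
    between [- 2 e] and [2 e]. *)
Lemma herm_limit x : archimedean_alg A ->
  (forall e, 0 < e -> exists u, is_herm u /\ norm_le (u - x) e) -> is_herm x.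
Proof.
move=> archA xu; pose h := imag A * (star x - x).
have Hh : is_herm h.
  rewrite /is_herm /= /h starM star_imag starB starK.
  by rewrite mulrN -mulNr -imagC opprB.
have : h = 0.
  apply: (herm_eq0 (w := 2)) archA Hh _ _ => [|e e0].
    by apply: hermD; exact: herm1.
  have [u [Hu du]] := xu e e0; set d := u - x in du.
  have dE : d - star d = star x - x.
    by rewrite /d starB Hu opprB addrC addrA subrK.
  have hE : h = imag A * d + star (imag A * d).
    by rewrite /h -dE mulrBr starM star_imag mulrN -imagC.
  split; first by rewrite hE; apply: hpos_real_part => //; exact: norm_le_imul.
  rewrite hE opprD -starN; apply: hpos_real_part => //.
  by apply/norm_leN; exact: norm_le_imul.
by move/imag_eq0/eqP; rewrite subr_eq0 => /eqP.
Qed.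

(* Multiplication by the unbounded [t] is not continuous, but with [d = u - x]
   of norm at most [e], [|e t +- i d|^2 >= 0] bounds [+- i (t d - d t)] by
   [e (t^2 + 1)]. *)
Lemma herm_limit_comm x t : archimedean_alg A -> is_herm x -> is_herm t ->
  (forall e, 0 < e ->
     exists u, [/\ is_herm u, t * u = u * t & norm_le (u - x) e]) ->
  t * x = x * t.
Proof.
move=> archA Hx Ht xu; pose h := imag A * (t * x - x * t).
have Hh : is_herm h.
  rewrite /is_herm /= /h starM star_imag starB !starM Hx Ht.
  by rewrite mulrN -mulNr -imagC opprB.
have Hw : is_herm (t * t + 1) by apply: hermD; [exact: hermM|exact: herm1].
have : h = 0.
  apply: (herm_eq0 (w := t * t + 1)) archA Hh Hw _ => e e0.
  have [u [Hu tu du]] := xu e e0; set d := u - x in du.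
  have Hd : is_herm d by exact: hermB.
  have hE : h = - (imag A * (t * d - d * t)).
    rewrite /h -[RHS]mulrN opprB; congr (imag A * _).
    by rewrite /d mulrBl mulrBr -tu opprB [RHS]addrC addrA subrK.
  have HT : is_herm (rscalar A e * t).
    by rewrite /is_herm /= starM Ht (herm_rscalar A) rscalarC.
  move/norm_le_herm : du => /(_ Hd) du.
  (* Taking [y = d] and [y = - d] gives the two signs. *)
  have key y : is_herm y -> y * y = d * d ->
      hpos (imag A * (t * y - y * t) + rscalar A e * (t * t + 1)).
    move=> Hy yd; apply: (hposZK e0).
    have := hposD (hpos_commutator HT Hy) du; rewrite -yd.
    have -> : rscalar A e * t * (rscalar A e * t) =
        rscalar A e * (rscalar A e * (t * t)).
      by rewrite -mulrA [t * (_ * t)]mulrA -rscalarC !mulrA.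
    have -> : imag A * (rscalar A e * t * y - y * (rscalar A e * t)) =
        rscalar A e * (imag A * (t * y - y * t)).
      by rewrite [y * _]mulrA -rscalarC -!mulrA -mulrBr !mulrA imagC.
    rewrite addrAC rmorphXn expr2 addrACA subrr addr0 addrC.
    by rewrite !mulrDr mulr1.
  split.
    have := key (- d) (hermN Hd) (mulrNN _ _); congr (hpos (_ + _)).
    by rewrite hE mulrN mulNr opprK -[RHS]mulrN opprB addrC.
  by have := key d Hd erefl; rewrite hE opprK.
by move/imag_eq0/eqP; rewrite subr_eq0 => /eqP.
Qed.

Lemma bicommutant_limit S x : archimedean_alg A ->
  (forall s, S s -> is_herm s) -> is_herm x ->
  (forall e, 0 < e ->
     exists u, [/\ is_herm u, bicommutant S u & norm_le (u - x) e]) ->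
  bicommutant S x.
Proof.
move=> archA HS Hx xu t St.
have St' := commutant_star HS St.
have comm_herm s : commutant S s -> is_herm s -> s * x = x * s.
  move=> Ss Hs; apply: herm_limit_comm => // e /xu[u [Hu Su du]].
  by exists u; split=> //; exact: Su.
have S1 : commutant S (t + star t).
  by move=> s Ss; rewrite mulrDr mulrDl St// St'.
have S2 : commutant S (imag A * (t - star t)).
  by move=> s Ss; rewrite mulrA -imagC -!mulrA mulrBr mulrBl St// St'.
have H1 := comm_herm _ S1 _; have H2 := comm_herm _ S2 _.
have {H1} : (t + star t) * x = x * (t + star t).
  by apply: H1; rewrite /is_herm /= starD starK addrC.
have {H2} : (t - star t) * x = x * (t - star t).
  have : imag A * ((t - star t) * x - x * (t - star t)) = 0.
    rewrite mulrBr mulrA H2; first by rewrite mulrA -imagC -mulrA subrr.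
    rewrite /is_herm /= starM star_imag starB starK.
    by rewrite mulrN -mulNr opprB -imagC.
  by move=> /imag_eq0/eqP; rewrite subr_eq0 => /eqP.
move=> H2 H1.
set c := t * x - x * t; set c' := star t * x - x * star t.
have E1 : c + c' = 0 by rewrite /c /c' addrACA -opprD -mulrDl -mulrDr H1 subrr.
have E2 : c - c' = 0.
  have -> : c - c' = (t - star t) * x - x * (t - star t).
    rewrite /c /c' mulrBl mulrBr !opprB addrACA [RHS]addrACA; congr (_ + _).
    exact: addrC.
  by rewrite H2 subrr.
have : rscalar A 2 * c = 0.
  rewrite rmorph_nat mulr_natl mulr2n.
  have -> : c + c = (c + c') + (c - c') by rewrite [RHS]addrACA subrr addr0.
  by rewrite E1 E2 addr0.
move/cscalar_eq0 => /(_ _)/eqP; rewrite subr_eq0 => H; apply/eqP/H.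
by rewrite -(rmorph0 (real_complex R)) (inj_eq (fmorph_inj _)) pnatr_eq0.
Qed.

End OrderedFacts.

(** * The Hermitian part of a bicommutant *)

Section HermitianBicommutant.
Variables (R : realType) (A : orderedStarAlgType R) (S : set A).
Implicit Types (a b s t x y : A) (r e : R).

(* Elements of [comm_core] commute pairwise whatever [S] is, so that
   [bicommutant comm_core] is commutative without a hypothesis on [S]. *)
Definition comm_core : set A :=
  [set s | [/\ S s, is_herm s & commutant S s]].

Lemma comm_core_herm s : comm_core s -> is_herm s. Proof. by case. Qed.

Definition hbicomm_pred : pred A :=
  fun x => `[< is_herm x /\ bicommutant comm_core x >].

Lemma hbicommP x :
  reflect (is_herm x /\ bicommutant comm_core x) (x \in hbicomm_pred).
Proof. exact: asboolP. Qed.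

(** Elements of [comm_core] commute with one another, so [comm_core] lies in its commutant; hence
    its bicommutant does too, and commutes with itself. *)
Lemma bicommutant_comm_core_comm x y :
  bicommutant comm_core x -> bicommutant comm_core y -> GRing.comm x y.
Proof.
move=> xS yS; apply/esym; apply: xS => s s_core.
apply: yS => t [St _ _]; case: s_core => _ _; exact.
Qed.

Lemma hbicomm_subring : subring_closed hbicomm_pred.
Proof.
split=> [|x y|x y].
- by apply/hbicommP; split=> [|t _]; [exact: herm1|rewrite mulr1 mul1r].
- move=> /hbicommP[Hx xS] /hbicommP[Hy yS]; apply/hbicommP; split.
    exact: hermB.
  by move=> t tS; rewrite mulrBr mulrBl xS// yS.
- move=> /hbicommP[Hx xS] /hbicommP[Hy yS]; apply/hbicommP; split.
    exact: hermM (bicommutant_comm_core_comm xS yS).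
  by move=> t tS; rewrite mulrA xS// -!mulrA yS.
Qed.

Record hbicomm := HBicomm { hbicomm_val : A ; _ : hbicomm_pred hbicomm_val }.

HB.instance Definition _ := [isSub for hbicomm_val].
HB.instance Definition _ := [Choice of hbicomm by <:].
HB.instance Definition _ :=
  GRing.SubChoice_isSubPzRing.Build A hbicomm_pred hbicomm hbicomm_subring.

Lemma hbicomm_mulC : @commutative hbicomm hbicomm *%R.
Proof.
move=> [x xP] [y yP]; apply: val_inj => /=.
move: xP yP => /hbicommP[_ xS] /hbicommP[_ yS].
exact: bicommutant_comm_core_comm.
Qed.

HB.instance Definition _ :=
  GRing.PzRing_hasCommutativeMul.Build hbicomm hbicomm_mulC.

Lemma hvalD (x y : hbicomm) :
  hbicomm_val (x + y) = hbicomm_val x + hbicomm_val y.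
Proof. by []. Qed.

Lemma hvalN (x : hbicomm) : hbicomm_val (- x) = - hbicomm_val x.
Proof. by []. Qed.

Lemma hvalM (x y : hbicomm) :
  hbicomm_val (x * y) = hbicomm_val x * hbicomm_val y.
Proof. by []. Qed.

Lemma hval1 : hbicomm_val 1 = 1. Proof. by []. Qed.

Lemma hvalX (x : hbicomm) n : hbicomm_val (x ^+ n) = hbicomm_val x ^+ n.
Proof. by elim: n => // n IH; rewrite !exprS hvalM IH. Qed.

Lemma hbicomm_val_inj : injective hbicomm_val.
Proof. exact: val_inj. Qed.

Definition hvalE := (hvalD, hvalN, hvalM, hval1, hvalX).

Lemma hbicomm_herm (x : hbicomm) : is_herm (hbicomm_val x).
Proof. by case: x => x /= /hbicommP[]. Qed.

Lemma hbicomm_bicommutant (x : hbicomm) : bicommutant comm_core (hbicomm_val x).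
Proof. by case: x => x /= /hbicommP[]. Qed.

Lemma hbicomm_lift x : is_herm x -> bicommutant comm_core x ->
  exists x' : hbicomm, hbicomm_val x' = x.
Proof.
move=> Hx xS; have xP := introT (hbicommP x) (conj Hx xS).
by exists (HBicomm xP).
Qed.

Lemma bicommutant_rscalar (S0 : set A) r : bicommutant S0 (rscalar A r).
Proof. by move=> t _; rewrite rscalarC. Qed.

Lemma hbicomm_scalarP r : rscalar A r \in hbicomm_pred.
Proof.
by apply/hbicommP; split; [exact: herm_rscalar|exact: bicommutant_rscalar].
Qed.

Definition hbicomm_scalar r : hbicomm := HBicomm (hbicomm_scalarP r).

Lemma hbicomm_scalar_is_zmod : zmod_morphism hbicomm_scalar.
Proof. by move=> y z; apply: val_inj; rewrite /= rmorphB. Qed.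

Lemma hbicomm_scalar_is_monoid : monoid_morphism hbicomm_scalar.
Proof. by split=> [|y z]; apply: val_inj; rewrite /= ?rmorph1 ?rmorphM. Qed.

HB.instance Definition _ :=
  GRing.isZmodMorphism.Build R hbicomm hbicomm_scalar hbicomm_scalar_is_zmod.
HB.instance Definition _ :=
  GRing.isMonoidMorphism.Build R hbicomm hbicomm_scalar
    hbicomm_scalar_is_monoid.

Definition hbicomm_pos (x : hbicomm) : Prop := hpos (hbicomm_val x).

Hypothesis archA : archimedean_alg A.

(** Stability under squares is [hle_conj]: here [x^* a x = x^2 a]. *)
Lemma hbicomm_cone : archimedean_cone hbicomm_scalar hbicomm_pos.
Proof.
split; rewrite /hbicomm_pos.
- by move=> a b Ha Hb; exact: hposD.
- move=> x a Ha; have := hpos_conj (hbicomm_val x) Ha.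
  by rewrite (hbicomm_herm x) -!hvalM mulrAC -expr2.
- exact: hpos1.
- by move=> a Ha Hna; apply: hbicomm_val_inj; exact: hpos_anti Ha Hna.
- move=> a w H; apply: (hpos_arch archA (hbicomm_herm a) (hbicomm_herm w)).
  move=> e /H.
  by rewrite hvalD hvalM.
Qed.

Lemma hbicomm_norm_le (x : hbicomm) e : 0 < e ->
  bounded_by hbicomm_scalar hbicomm_pos x e <-> norm_le (hbicomm_val x) e.
Proof.
move=> e0; apply: iff_trans (bounded_by_sqr hbicomm_cone x e0) _.
apply: iff_trans (iff_sym (norm_le_herm e (hbicomm_herm x))).
by rewrite /hbicomm_pos !hvalE !rmorphXn !expr2.
Qed.

(** The limit found in [A] is Hermitian by [herm_limit] and stays in the bicommutant by
    [bicommutant_limit]. *)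
Lemma hbicomm_complete : uniformly_complete A ->
  cone_complete hbicomm_scalar hbicomm_pos.
Proof.
move=> complA u cu.
have [e e0|x ux] := norm_complete (u := fun n => hbicomm_val (u n)) complA.
  have [N HN] := cu e e0; exists N => m n Nm Nn.
  by apply/(hbicomm_norm_le (u m - u n)) => //; exact: HN.
have near_x e : 0 < e -> exists n, norm_le (hbicomm_val (u n) - x) e.
  by move=> /ux[N /(_ N (leqnn N))]; exists N.
have Hx : is_herm x.
  apply: herm_limit archA _ => e /near_x[n Hn].
  by exists (hbicomm_val (u n)); split=> //; exact: hbicomm_herm.
have xS : bicommutant comm_core x.
  apply: bicommutant_limit archA comm_core_herm Hx _ => e /near_x[n Hn].
  exists (hbicomm_val (u n)); split=> //; first exact: hbicomm_herm.
  exact: hbicomm_bicommutant.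
have [x' xE] := hbicomm_lift Hx xS.
exists x' => e e0; have [N HN] := ux e e0; exists N => n /HN.
by rewrite -xE => /(hbicomm_norm_le (u n - x')); apply.
Qed.

(** The inverse [y] taken in [A] is Hermitian by uniqueness, since [x y^* = (y x)^* = 1], and it
    commutes with whatever commutes with [x]. *)
Lemma hbicomm_inv (x : hbicomm) : is_invertible (hbicomm_val x) ->
  exists t : hbicomm, x * t = 1.
Proof.
move=> [y [xy yx]].
have inv_uniq z : hbicomm_val x * z = 1 -> z = y.
  by move=> xz; rewrite -[z]mul1r -yx -mulrA xz mulr1.
have Hy : is_herm y.
  apply: inv_uniq; rewrite -[in LHS](hbicomm_herm x) -starM yx; exact: star1.
have [||y' yE] := @hbicomm_lift y => //.
  move=> t tS.
  have tx : t * hbicomm_val x = hbicomm_val x * t.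
    exact: hbicomm_bicommutant.
  rewrite -[t * y]mul1r -yx -!mulrA [hbicomm_val x * _]mulrA -tx.
  by rewrite -mulrA xy mulr1.
rewrite -yE in xy; exists y'; apply: val_inj; exact: xy.
Qed.

Lemma hbicomm_invertible (x t : hbicomm) :
  x * t = 1 -> is_invertible (hbicomm_val x).
Proof.
by move=> xt; exists (hbicomm_val t); rewrite -!hvalM [t * x]mulrC xt.
Qed.

Lemma hbicomm_coercive (x : hbicomm) e : 0 < e ->
  hbicomm_pos (x - hbicomm_scalar e) -> coercive (hbicomm_val x).
Proof.
move=> e0 xe; split; first exact: hbicomm_herm.
exists e; split=> //; apply/hle_hpos; first exact: herm_rscalar.
exact: xe.
Qed.

Lemma coercive_hbicomm (x : hbicomm) : coercive (hbicomm_val x) ->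
  exists2 e, 0 < e & hbicomm_pos (x - hbicomm_scalar e).
Proof.
move=> [_ [e [e0 /hle_hpos H]]]; exists e => //.
by apply: H; exact: herm_rscalar.
Qed.

Lemma hbicomm_symmetric : symmetric_alg A ->
  cone_symmetric hbicomm_scalar hbicomm_pos.
Proof.
move=> symA a e e0 ae; apply: hbicomm_inv; apply: symA.
exact: hbicomm_coercive ae.
Qed.

Lemma hbicomm_radical : radical_alg A ->
  cone_radical hbicomm_scalar hbicomm_pos.
Proof.
move=> radA a b e e0 ae ab0; apply: (radA (hbicomm_val a) (hbicomm_val b)).
- exact: hbicomm_herm.
- exact: hbicomm_herm.
- by rewrite /GRing.comm -!hvalM mulrC.
- exact: hbicomm_coercive ae.
- exact: ab0.
Qed.

End HermitianBicommutant.

(** * The equivalences *)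

Section Equivalences.
Variables (R : realType) (A : orderedStarAlgType R).
Hypotheses (archA : archimedean_alg A) (complA : uniformly_complete A).
Implicit Types (a b s t x y : A) (r e : R).

(** Identifies the bicommutant behind [hbicomm] with the one in [is_sqrt]. *)
Lemma comm_core1 a : is_herm a -> comm_core [set a] = [set a].
Proof.
by move=> Ha; apply/seteqP; split=> [s []//|s ->]; split=> // t ->.
Qed.

Lemma comm_core2 a b : is_herm a -> is_herm b -> GRing.comm a b ->
  comm_core [set a; b] = [set a; b].
Proof.
move=> Ha Hb ab; apply/seteqP; split=> [s []//|s [->|->]];
  split=> //; try by [left|right].
  by move=> t [->|->].
by move=> t [->|->].
Qed.

Lemma bicommutant_incl (S : set A) s : S s -> bicommutant S s.
Proof. by move=> Ss t tS; apply/esym/tS. Qed.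

Lemma hbicomm_lift1 a : is_herm a ->
  exists a' : hbicomm [set a], hbicomm_val a' = a.
Proof.
move=> Ha; apply: hbicomm_lift => //; rewrite comm_core1//.
exact: bicommutant_incl.
Qed.

Lemma hbicomm_lift2 a b : is_herm a -> is_herm b -> GRing.comm a b ->
  exists a' b' : hbicomm [set a; b], hbicomm_val a' = a /\ hbicomm_val b' = b.
Proof.
move=> Ha Hb ab; have E := comm_core2 Ha Hb ab.
have [||a' aE] := @hbicomm_lift _ _ [set a; b] a => //.
  by rewrite E; apply: bicommutant_incl; left.
have [||b' bE] := @hbicomm_lift _ _ [set a; b] b => //.
  by rewrite E; apply: bicommutant_incl; right.
by exists a', b'.
Qed.

(** * The implications of the cycle *)

Lemma resolvent_factor a :
  (a + (0 +i* 1) **: 1) * (a - (0 +i* 1) **: 1) = a * a + 1 /\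
  (a - (0 +i* 1) **: 1) * (a + (0 +i* 1) **: 1) = a * a + 1.
Proof.
rewrite -/(cscalar A _) -/(imag A).
rewrite !(mulrDl, mulrDr) !mulrN !mulNr imagM imagC !opprK.
by split; [rewrite addrA subrK|rewrite addrA addrK].
Qed.

Lemma invertibleM a b :
  is_invertible a -> is_invertible b -> is_invertible (a * b).
Proof.
move=> [a' [aa' a'a]] [b' [bb' b'b]]; exists (b' * a'); split.
  by rewrite mulrA -[a * b * b']mulrA bb' mulr1.
by rewrite mulrA -[b' * a' * a]mulrA a'a mulr1.
Qed.

(** [c] commutes with [a] and [b], hence so does its inverse [d]; the inverses are [b d] and
    [a d]. *)
Lemma invertible_factors a b c : a * b = c -> b * a = c ->
  is_invertible c -> is_invertible a /\ is_invertible b.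
Proof.
move=> abc bac [d [cd dc]].
have ac : a * c = c * a by rewrite -{1}bac mulrA abc.
have bc : b * c = c * b by rewrite -{1}abc mulrA bac.
have inv_comm u : u * c = c * u -> d * u = u * d.
  by move=> uc; rewrite -[u in LHS]mulr1 -cd [u * _]mulrA uc !mulrA dc mul1r.
split; [exists (b * d)|exists (a * d)]; split.
- by rewrite mulrA abc.
- by rewrite -inv_comm// -mulrA bac.
- by rewrite mulrA bac.
- by rewrite -inv_comm// -mulrA abc.
Qed.

(** The elements [a + i] and [a - i] need not be Hermitian; only their product [a^2 + 1] is inverted
    inside [hbicomm]. *)
Lemma symmetric_of_resolvent :
  (forall a, is_herm a -> is_invertible (a + (0 +i* 1) **: 1) /\
     is_invertible (a - (0 +i* 1) **: 1)) -> symmetric_alg A.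
Proof.
move=> resA a ca; have Ha : is_herm a by case: ca.
have [a' aE] := hbicomm_lift1 Ha.
have [s sE] : exists s : hbicomm [set a], (a' ^+ 2 + 1) * s = 1.
  apply: hbicomm_inv; rewrite !hvalE expr2 aE.
  rewrite -(resolvent_factor a).1.
  by apply: invertibleM; have [] := resA a Ha.
have [|e e0 ae] := @coercive_hbicomm _ _ _ a'; first by rewrite aE.
have [t tE] := resolvent_inv (hbicomm_cone _ archA)
  (hbicomm_complete archA complA) sE e0 ae.
by rewrite -aE; exact: hbicomm_invertible tE.
Qed.

Lemma radical_of_symmetric : symmetric_alg A -> radical_alg A.
Proof.
move=> symA a b Ha Hb ab ca ab0.
have [a' [b' [aE bE]]] := hbicomm_lift2 Ha Hb ab.
have [|e e0 ae] := @coercive_hbicomm _ _ _ a'; first by rewrite aE.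
have := symmetric_radical (hbicomm_cone _ archA) (hbicomm_complete archA complA)
  (hbicomm_symmetric symA) e0 ae (b := b').
by rewrite /hbicomm_pos hvalM aE bE; apply.
Qed.

Lemma sqrt_of_symmetric a : symmetric_alg A -> hpos a -> exists x, is_sqrt a x.
Proof.
move=> symA a0; have Ha := hpos_herm a0.
have [a' aE] := hbicomm_lift1 Ha.
have [|y [y0 yE]] := symmetric_sqrt (hbicomm_cone _ archA)
  (hbicomm_complete archA complA) (hbicomm_symmetric symA) (a := a').
  by rewrite /hbicomm_pos aE.
exists (hbicomm_val y); split=> //; last by rewrite -hvalX yE.
by have := @hbicomm_bicommutant _ _ _ y; rewrite comm_core1.
Qed.

(** For the pair [a], [- a] the join conditions reduce to [2 x >= 0] and [x^2 = a^2]; and what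
    commutes with [a] commutes with [a^2]. *)
Lemma abs_of_sqrt a : is_herm a ->
  (forall b, hpos b -> exists x, is_sqrt b x) -> exists x, is_abs a x.
Proof.
move=> Ha sqrtA; have [|x [xS x0 xE]] := sqrtA (a * a).
  by have := hpos_star_mul a; rewrite Ha.
exists x; split.
- apply: sub_bicommutant xS => t tS s ->; have at_ := tS a (or_introl erefl).
  by rewrite -mulrA at_ mulrA at_ mulrA.
- exact: hpos_herm.
- by rewrite subrr mulr2n; exact: hposD.
- by rewrite xE mulrN !subrr mulr0.
Qed.

Lemma hpos_mulr2n x : hpos (x *+ 2) -> hpos x.
Proof.
by move=> H; apply: (@hposZK _ _ 2) => //; rewrite rmorph_nat mulr_natl.
Qed.

(** With [m = |a - b|] the witnesses are [(a + b + m) / 2] and [(a + b - m) / 2]; their equations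
    follow from [m^2 = (a - b)^2]. *)
Lemma join_meet_of_abs a b : (forall a, is_herm a -> exists x, is_abs a x) ->
  is_herm a -> is_herm b -> GRing.comm a b ->
  (exists x, is_join a b x) /\ (exists x, is_meet a b x).
Proof.
move=> absA Ha Hb ab; have [m [mS Hm m0 mE]] := absA (a - b) (hermB Ha Hb).
have [a' [b' [aE bE]]] := hbicomm_lift2 Ha Hb ab.
have mS' : bicommutant [set a; b] m.
  apply: sub_bicommutant mS => t tS.
  have ta := tS a (or_introl erefl); have tb := tS b (or_intror erefl).
  by move=> s [->|->]; rewrite ?mulNr ?mulrN mulrBl mulrBr ta tb.
have [||m' mE'] := @hbicomm_lift _ _ [set a; b] m => //.
  by rewrite comm_core2.
have m2 : m' ^+ 2 = (a' - b') ^+ 2.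
  apply: hbicomm_val_inj; rewrite !hvalE mE' aE bE.
  move: mE; rewrite subrr mulr0 mulrN => /eqP; rewrite subr_eq0 => /eqP ->.
  by rewrite expr2.
have {}m0 : hpos m.
  by apply: hpos_mulr2n; move: m0; rewrite subrr.
(* One half, kept abstract; [h4E] and [h2E] make the equations below homogeneous in [h], so that
   [ring] needs only [m2]. *)
have [h h2] : exists h : hbicomm [set a; b], h + h = 1.
  exists (hbicomm_scalar [set a; b] 2^-1).
  by rewrite -rmorphD (_ : 2^-1 + 2^-1 = 1) ?rmorph1//; lra.
have h4E (x : hbicomm [set a; b]) : x = (h + h) * (h + h) * x.
  by rewrite h2 !mul1r.
have h2E (x : hbicomm [set a; b]) : h * x + h * x = x.
  by rewrite -mulrDl h2 mul1r.
split.
  exists (hbicomm_val (h * (a' + b' + m'))); split.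
  - have := @hbicomm_bicommutant _ _ _ (h * (a' + b' + m')).
    by rewrite comm_core2.
  - exact: hbicomm_herm.
  - apply/hle_hpos; first exact: hermD.
    by rewrite mulr2n -hvalD h2E !hvalE aE bE mE' addrC addKr.
  - have /(congr1 (@hbicomm_val _ _ _)) : (h * (a' + b' + m')) ^+ 2 + a' * b' =
        h * (a' + b' + m') * (a' + b').
      by rewrite [a' * b']h4E -[RHS]h2E; ring: m2.
    by rewrite !hvalE aE bE.
exists (hbicomm_val (h * (a' + b' - m'))); split.
- have := @hbicomm_bicommutant _ _ _ (h * (a' + b' - m')).
  by rewrite comm_core2.
- exact: hbicomm_herm.
- apply/hle_hpos; first by rewrite mulr2n; apply: hermD; exact: hbicomm_herm.
  by rewrite mulr2n -hvalD h2E !hvalE aE bE mE' subKr.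
- have /(congr1 (@hbicomm_val _ _ _)) : (h * (a' + b' - m')) ^+ 2 + a' * b' =
      h * (a' + b' - m') * (a' + b').
    by rewrite [a' * b']h4E -[RHS]h2E; ring: m2.
  by rewrite !hvalE aE bE.
Qed.

(** Only meets with [1] are given, so the meet of [c] with a positive integer [n] is obtained as [n]
    times the meet of [c / n] with [1]. *)
Lemma invertible_of_meet : radical_alg A ->
  (forall a, hpos a -> coercive a -> exists x, is_meet a 1 x) ->
  forall c : A, hpos (c - 1) -> is_invertible c.
Proof.
move=> radA meetA c c1.
have Hc : is_herm c.
  by rewrite -(subrK 1 c); apply: hermD; [exact: hpos_herm|exact: herm1].
have [c' cE] := hbicomm_lift1 Hc.
have K := hbicomm_cone [set c] archA.
have c1' : hbicomm_pos (c' - 1) by rewrite /hbicomm_pos !hvalE cE.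
have meetc (n : nat) : exists x : hbicomm [set c],
    cone_meet (@hbicomm_pos _ _ _) c' (hbicomm_scalar _ n.+1%:R) x.
  set l := hbicomm_scalar _ _; pose r := hbicomm_scalar [set c] n.+1%:R^-1.
  have rl : r * l = 1 by rewrite -rmorphM mulVf ?rmorph1// pnatr_eq0.
  have r0 : 0 < n.+1%:R^-1 :> R by rewrite invr_gt0.
  have l_pos (x : hbicomm [set c]) : hbicomm_pos x -> hbicomm_pos (l * x).
    exact: coneZ.
  have rc1 : hbicomm_pos (r * c' - r).
    by have := coneZ K (ltW r0) c1'; rewrite mulrBr mulr1.
  have rc0 : hbicomm_pos (r * c').
    by have := coneD K rc1 (coneC K (ltW r0)); rewrite subrK.
  have [y [yS Hy y2 yE]] := meetA _ rc0 (hbicomm_coercive r0 rc1).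
  have [||y' yE'] := @hbicomm_lift _ _ [set c] y => //.
    rewrite comm_core1//; apply: sub_bicommutant yS => t tS.
    have ct : c * t = t * c by exact: tS.
    move=> s [->|->]; last by rewrite mul1r mulr1.
    by rewrite hvalM cE -mulrA ct mulrA rscalarC mulrA.
  have {}yE : y' ^+ 2 + r * c' = y' * (r * c' + 1).
    by apply: hbicomm_val_inj; rewrite !hvalE yE' -yE mulr1.
  have {}y2 : hbicomm_pos (r * c' + 1 - y' *+ 2).
    move/hle_hpos : y2; rewrite /hbicomm_pos !mulr2n !hvalE yE'; apply.
    exact: hermD.
  clearbody l r; exists (l * y'); split.
    by have := l_pos _ y2; congr (hbicomm_pos _); ring: rl.
  have -> : (l * y') ^+ 2 + c' * l = l ^+ 2 * (y' ^+ 2 + r * c') by ring: rl.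
  by rewrite yE; ring: rl.
have [t tE] := radical_meet_inv K (hbicomm_complete archA complA)
  (hbicomm_radical radA) c1' meetc.
by rewrite -cE; exact: hbicomm_invertible tE.
Qed.

(** [a^2 + 1] exceeds [1] by [a^* a >= 0], so it is invertible, and its commuting factors inherit
    this. *)
Lemma resolvent_of_meet : radical_alg A ->
  (forall a, hpos a -> coercive a -> exists x, is_meet a 1 x) ->
  forall a, is_herm a -> is_invertible (a + (0 +i* 1) **: 1) /\
     is_invertible (a - (0 +i* 1) **: 1).
Proof.
move=> radA meetA a Ha; have [H1 H2] := resolvent_factor a.
apply: invertible_factors H1 H2 _; apply: invertible_of_meet => //.
by rewrite addrK; have := hpos_star_mul a; rewrite Ha.
Qed.

End Equivalences.

Theorem theorem7p1 (R : realType) (A : orderedStarAlgType R)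
    (archA : archimedean_alg A) (complA : uniformly_complete A) :
  [<->
    (forall a : A, is_herm a ->
       is_invertible (a + (0 +i* 1) **: 1) /\
       is_invertible (a - (0 +i* 1) **: 1));
    symmetric_alg A;
    (radical_alg A /\
       forall a : A, hpos a -> exists x : A, is_sqrt a x);
    (radical_alg A /\
       forall a : A, is_herm a -> exists x : A, is_abs a x);
    phi_star_alg A;
    (radical_alg A /\
       forall a : A, hpos a -> coercive a -> exists x : A, is_meet a 1 x)].
Proof.
tfae.
- exact: symmetric_of_resolvent.
- move=> symA; split; first exact: radical_of_symmetric.
  by move=> a; exact: sqrt_of_symmetric.
- by move=> [radA sqrtA]; split=> // a Ha; exact: abs_of_sqrt.
- by move=> [radA absA]; split=> // a b Ha Hb ab; exact: join_meet_of_abs.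
- move=> [_ radA latA]; split=> // a a0 _.
  have [] := latA a 1 (hpos_herm a0) (herm1 A) _ => //.
  by rewrite /GRing.comm mulr1 mul1r.
- by move=> [radA meetA]; exact: resolvent_of_meet.
Qed.
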